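(* For each positive integer $n$ let $\Gamma_n$ be an Erdős–Rényi random graph with $n$ vertices. Then, as $n \to \infty$, the probability that there exists a finite group $G$ such that $\Gamma_n \cong \Delta_G$ or $\Gamma_n \cong \Delta_G^c$ tends to $0$.
   Context: For a finite group $G$, the intersection graph $\Delta_G$ is the simple graph whose vertices are the nontrivial proper subgroups of $G$, two distinct subgroups being adjacent if and only if they intersect nontrivially. The co-intersection graph $\Delta_G^c$ is its graph-theoretic complement: same vertices, with two distinct subgroups adjacent if and only if they intersect trivially. An Erdős–Rényi random graph with $n$ vertices is the random graph on $n$ labelled vertices in which each of the $\binom{n}{2}$ possible edges is present independently with probability $1/2$ (equivalently, a uniformly random labelled graph on $n$ vertices). *)

(* Defs.v *)
From HB Require Import structures.
From mathcomp Require Import all_boot all_order all_algebra all_fingroup.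
From mathcomp Require Import boolp classical_sets reals topology normedtype sequences.

Set Implicit Arguments.
Unset Strict Implicit.
Unset Printing Implicit Defensive.

Import Order.TTheory GRing.Theory Num.Theory.
Import numFieldNormedType.Exports.

Record sgraph := SGraph {
  vertex :> finType;
  adj : rel vertex;
  adj_sym : symmetric adj;
  adj_irr : irreflexive adj }.

Definition sgraph_iso (X Y : sgraph) : Prop :=
  exists2 f : X -> Y, bijective f & forall x y : X, adj (f x) (f y) = adj x y.

Section Complement.
Variable X : sgraph.

Definition compl_adj : rel X := fun x y => (x != y) && ~~ adj x y.

Lemma compl_adj_sym : symmetric compl_adj.
Proof. by move=> x y; rewrite /compl_adj eq_sym adj_sym. Qed.

Lemma compl_adj_irr : irreflexive compl_adj.
Proof. by move=> x; rewrite /compl_adj eqxx. Qed.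

Definition compl_sgraph : sgraph := SGraph compl_adj_sym compl_adj_irr.

End Complement.

Section IntersectionGraph.
Variables (gT : finGroupType) (G : {group gT}).

Definition proper_nontrivial : pred {group gT} :=
  fun H => (H \proper G) && (H :!=: 1%g).

Definition inter_adj : rel {H : {group gT} | proper_nontrivial H} :=
  fun H K => (H != K) && (val H :&: val K != 1%g).

Lemma inter_adj_sym : symmetric inter_adj.
Proof. by move=> H K; rewrite /inter_adj eq_sym finset.setIC. Qed.

Lemma inter_adj_irr : irreflexive inter_adj.
Proof. by move=> H; rewrite /inter_adj eqxx. Qed.

Definition inter_graph : sgraph := SGraph inter_adj_sym inter_adj_irr.

End IntersectionGraph.

Section RandomGraph.
Variable n : nat.

Definition vertex_pairs : {set {set 'I_n}} := [set e : {set 'I_n} | #|e| == 2%N].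

Definition edge_adj (E : {set {set 'I_n}}) : rel 'I_n :=
  fun i j => (i != j) && ([set i; j] \in E).

Lemma edge_adj_sym E : symmetric (edge_adj E).
Proof. by move=> i j; rewrite /edge_adj eq_sym finset.setUC. Qed.

Lemma edge_adj_irr E : irreflexive (edge_adj E).
Proof. by move=> i; rewrite /edge_adj eqxx. Qed.

Definition labelled_graph (E : {set {set 'I_n}}) : sgraph :=
  SGraph (edge_adj_sym E) (edge_adj_irr E).

Variables (R : realType) (p : R).

(* Probability that the edge set of G(n, p) is exactly E, for E a set of
   vertex pairs: the product, by independence, over all potential edges. *)
Definition ER_weight (E : {set {set 'I_n}}) : R :=
  (\prod_(e in vertex_pairs) (if e \in E then p else 1 - p))%R.

Definition ER_prob (event : sgraph -> Prop) : R :=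
  (\sum_(E : {set {set 'I_n}} | (E \subset vertex_pairs) &&
                                `[< event (labelled_graph E) >]) ER_weight E)%R.

End RandomGraph.

Definition group_representable (X : sgraph) : Prop :=
  exists (gT : finGroupType) (G : {group gT}),
    sgraph_iso X (inter_graph G) \/ sgraph_iso X (compl_sgraph (inter_graph G)).

(* Main.v *)
(** If [1 < H <= K] with [H != K], every subgroup meeting [H] nontrivially meets
    [K] nontrivially, so the neighbours of [H] other than [K] are neighbours of
    [K]: [K] dominates [H]. Any edge [H K] of an intersection graph produces
    such a pair, as [H :&: K] is a vertex lying below both ends; an edgeless
    graph has dominating pairs trivially. Hence every intersection graph with at
    least two vertices has a dominating pair, and so does its complement, since
    complementation reverses domination. In the random graph a given pair of
    vertices is dominating with probability [(3/4)^(n-2)], and [n^2 (3/4)^(n-2)]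
    tends to 0. *)

Require Import Defs.
From HB Require Import structures.
From mathcomp Require Import all_boot all_order all_algebra all_fingroup.
From mathcomp Require Import boolp classical_sets reals topology normedtype sequences.
(* Re-imported so that [subsetP], [setP], etc. denote the finset lemmas. *)
From mathcomp Require Import fintype finset.
From mathcomp Require Import zify lra.

Import Order.TTheory GRing.Theory Num.Theory.
Import numFieldNormedType.Exports.

(** Leaving the two ends out of the range of [z] makes the relation independent of whether [x] and
    [y] are adjacent; this is what lets complementation reverse it exactly. *)
Definition dominates (X : sgraph) : rel X := fun y x =>
  (x != y) && [forall z, [&& z != x, z != y & adj x z] ==> adj y z].

Arguments dominates : clear implicits.

Lemma dominatesP (X : sgraph) (y x : X) :
  reflect (x != y /\ forall z, z != x -> z != y -> adj x z -> adj y z)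
          (dominates X y x).
Proof.
apply: (iffP andP) => -[nxy dom]; split=> //.
  by move=> z zx zy xz; have /forallP/(_ z) := dom; rewrite zx zy xz.
by apply/forallP => z; apply/implyP => /and3P[zx zy]; apply: dom.
Qed.

Lemma dominates_compl (X : sgraph) (y x : X) :
  dominates X y x -> dominates (compl_sgraph X) x y.
Proof.
move=> /dominatesP[nxy dom]; apply/dominatesP; split; first by rewrite eq_sym.
move=> z zy zx /andP[_ nyz]; rewrite /= /compl_adj eq_sym zx.
by apply: contra nyz; apply: dom.
Qed.

Lemma dominates_iso (X Y : sgraph) (f : X -> Y) (y x : X) : bijective f ->
  (forall u v, adj (f u) (f v) = adj u v) ->
  dominates Y (f y) (f x) -> dominates X y x.
Proof.
move=> /bij_inj inj_f adjf /dominatesP[nxy dom]; apply/dominatesP.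
split=> [|z zx zy]; first by apply: contraNneq nxy => ->.
by rewrite -!adjf; apply: dom; rewrite inj_eq.
Qed.

Lemma inter_graph_dominates (gT : finGroupType) (G : {group gT}) :
  1 < #|inter_graph G| -> exists y x, dominates (inter_graph G) y x.
Proof.
move=> /card_gt1P[H0 [K0 [_ _ nHK0]]].
have [/existsP[H /existsP[K adjHK]]|noedge] :=
  boolP [exists H : inter_graph G, exists K : inter_graph G, adj H K]; last first.
  exists K0, H0; apply/dominatesP; split=> // L _ _ adjHL.
  by case/existsP: noedge; exists H0; apply/existsP; exists L.
have /andP[nHK ntHK] : (H != K) && (val H :&: val K != 1%g) := adjHK.
have propI : proper_nontrivial G (val H :&: val K)%G.
  rewrite /proper_nontrivial ntHK andbT.
  by apply: sub_proper_trans (subsetIl _ _) _; case/andP: (valP H).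
pose I : inter_graph G := exist (fun L => proper_nontrivial G L) _ propI.
have below (L : inter_graph G) : I != L -> val I \subset val L ->
    dominates (inter_graph G) L I.
  move=> nIL sIL; apply/dominatesP; split=> // M nMI nML /andP[_ ntIM].
  apply/andP; split; first by rewrite eq_sym.
  by apply: contraNneq ntIM => LM1; rewrite -subG1 -LM1 setSI.
(* As [H != K], the intersection [I] differs from at least one of the two ends, and that end
   dominates it. *)
have [eIH|nIH] := eqVneq I H; last by exists H, I; rewrite below // subsetIl.
by exists K, I; rewrite below ?subsetIr // eIH.
Qed.

Lemma representable_dominates (X : sgraph) :
  1 < #|X| -> group_representable X -> exists y x, dominates X y x.
Proof.
move=> gt1X [gT [G [] [f bij_f adjf]]].
- have := gt1X; rewrite (bij_eq_card bij_f) => /inter_graph_dominates[y [x dom]].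
  have [g _ fK] := bij_f; exists (g y), (g x).
  by apply: (dominates_iso _ _ f) => //; rewrite !fK.
- have := gt1X; rewrite (bij_eq_card bij_f) => /inter_graph_dominates[y [x dom]].
  have [g _ fK] := bij_f; exists (g x), (g y).
  by apply: (dominates_iso _ _ f) => //; rewrite !fK; apply: dominates_compl.
Qed.

Section CountDominating.
Variables (n : nat) (y x : 'I_n).
Hypothesis nxy : x != y.

Let D : {set 'I_n} := ~: [set x; y].
Let Sx : {set {set 'I_n}} := [set [set x; z] | z in D].
Let Sy : {set {set 'I_n}} := [set [set y; z] | z in D].
(** For [z] in [D], the two bits tell whether [xz] and [yz] are edges; domination of [x] by [y]
    forbids only [(true, false)]. *)
Let patterns : {set bool * bool} := [set p : bool * bool | p.1 ==> p.2].

Let inD z : (z \in D) = (z != x) && (z != y).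
Proof. by rewrite !inE negb_or. Qed.

Let pair_inj (u : 'I_n) : {in [pred z | z != u] &, injective (fun z => [set u; z])}.
Proof.
move=> z t; rewrite !inE => zu tu /setP/(_ z).
by rewrite !inE eqxx orbT (negPf zu) => /esym/eqP.
Qed.

Let card_Sx : #|Sx| = #|D|.
Proof.
by apply: card_in_imset => z t; rewrite !inD => /andP[? _] /andP[? _]; apply: pair_inj.
Qed.

Let card_Sy : #|Sy| = #|D|.
Proof.
by apply: card_in_imset => z t; rewrite !inD => /andP[_ ?] /andP[_ ?]; apply: pair_inj.
Qed.

(** [Sx] and [Sy] are disjoint, since [x] lies in every pair of [Sx] and in none of [Sy]. The two
    copies of [#|D|] supply the [4 ^ #|D|] in the count below. *)
Let card_pairs :
  #|vertex_pairs n| = (#|D| + #|D| + #|vertex_pairs n :\: (Sx :|: Sy)|)%N.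
Proof.
have sub : Sx :|: Sy \subset vertex_pairs n.
  apply/subsetP => e /setUP[] /imsetP[z + ->]; rewrite inD inE cards2 eqSS.
    by rewrite eq_sym; case/andP=> ->.
  by rewrite [y == z]eq_sym; case/andP=> _ ->.
rewrite -{1}card_Sx -card_Sy -(cardsID (Sx :|: Sy) (vertex_pairs n)).
congr (_ + _)%N; rewrite (setIidPr sub) cardsU card_Sx card_Sy.
suff -> : Sx :&: Sy = set0 by rewrite cards0 subn0.
apply/setP => e; rewrite !inE; apply/negP => /andP[/imsetP[z + ->] /imsetP[t + ezt]].
rewrite !inD => /andP[_ zy] /andP[tx _]; move/setP/(_ x): ezt.
by rewrite !inE eqxx /= (negPf nxy) eq_sym (negPf tx).
Qed.

(* [code] is injective, and each of the [#|D|] pairs of edges it records takes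
   only three of its four possible values when [y] dominates [x]. *)
Let code (E : {set {set 'I_n}}) : {set {set 'I_n}} * {ffun 'I_n -> bool * bool} :=
  (E :\: (Sx :|: Sy),
   [ffun z => if z \in D then ([set x; z] \in E, [set y; z] \in E)
              else (false, false)]).

(** The probability bound [(3/4) ^ #|D|] with denominators cleared, so that the counting stays in
    [nat]. *)
Lemma card_dominating :
  (#|[set E : {set {set 'I_n}} | (E \subset vertex_pairs n) &&
                                 dominates (labelled_graph E) y x]|
     * 4 ^ #|~: [set x; y]| <= 3 ^ #|~: [set x; y]| * 2 ^ #|vertex_pairs n|)%N.
Proof.
rewrite -/D; set A := [set E | _].
have code_inj : injective code.
  move=> E F [eD /ffunP ef]; apply/setP => e.
  have [|neS] := boolP (e \in Sx :|: Sy); last first.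
    by move/setP/(_ e): eD; rewrite !in_setD neS.
  rewrite inE => /orP[] /imsetP[z zD ->]; have := ef z; rewrite !ffunE zD;
    by case.
have cardP : #|patterns| = 3.
  have -> : patterns = ~: [set (true, false)].
    by apply/setP => -[[] []]; rewrite !inE.
  by rewrite cardsC1 card_prod card_bool.
(* The default value [(false, false)] of [code] off [D] is the one [pffun_on] asks for, so the
   second factor has [3 ^ #|D|] elements. *)
pose B := setX (powerset (vertex_pairs n :\: (Sx :|: Sy)))
               [set f in pffun_on (false, false) D patterns].
have subAB : [set code E | E in A] \subset B.
  apply/subsetP => _ /imsetP[E + ->].
  rewrite inE => /andP[subE /dominatesP[_ dom]]; rewrite !inE setSD //=.
  apply/pffun_onP; split.
    by apply/subsetP => z; rewrite inE ffunE; case: ifP; rewrite ?eqxx.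
  move=> _ /imageP[z zD ->]; rewrite ffunE zD inE /=; apply/implyP => xzE.
  have := zD; rewrite inD => /andP[zx zy].
  by have /andP[] : edge_adj E y z;
    [apply: dom; rewrite //= /edge_adj eq_sym zx|].
have := subset_leq_card subAB.
rewrite card_imset // cardsX card_powerset [X in (_ * X)%N]cardsE card_pffun_on cardP.
rewrite card_pairs => leA; apply: leq_trans (leq_mul leA (leqnn _)) _.
by rewrite !expnD -(expnMn 2 2) -mulnA mulnC -!mulnA leq_mul2l mulnC leqnn orbT.
Qed.

End CountDominating.

Lemma card_bigcup_le (I T : finType) (P : pred I) (F : I -> {set T}) :
  (#|\bigcup_(i | P i) F i| <= \sum_(i | P i) #|F i|)%N.
Proof.
elim/big_rec2: _ => [|i m A _ leA]; first by rewrite cards0.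
by rewrite cardsU (leq_trans (leq_subr _ _)) ?leq_add2l.
Qed.

(** Union bound over all ordered pairs [(y, x)]; the diagonal ones contribute nothing. With [n.+2]
    vertices, [n] remain outside a pair. *)
Lemma card_pairs_dominating (n : nat) :
  (#|[set E : {set {set 'I_n.+2}} | (E \subset vertex_pairs n.+2) &&
              [exists y, exists x, dominates (labelled_graph E) y x]]| * 4 ^ n
     <= n.+2 ^ 2 * (3 ^ n * 2 ^ #|vertex_pairs n.+2|))%N.
Proof.
pose A y x := [set E : {set {set 'I_n.+2}} | (E \subset vertex_pairs n.+2) &&
                                             dominates (labelled_graph E) y x].
have leA y x : (#|A y x| * 4 ^ n <= 3 ^ n * 2 ^ #|vertex_pairs n.+2|)%N.
  have [xy|nxy] := eqVneq x y.
    by rewrite eq_card0 // => E; rewrite inE /dominates xy eqxx andbF.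
  have cardD : #|~: [set x; y]| = n.
    by rewrite cardsCs setCK cards2 nxy card_ord subSS subn1.
  by have := @card_dominating _ _ _ nxy; rewrite cardD.
set B := [set E | _].
have leB : (#|B| <= \sum_y \sum_x #|A y x|)%N.
  have -> : B = \bigcup_y \bigcup_x A y x.
    apply/setP => E; rewrite inE; apply/andP/bigcupP.
      move=> [sE /existsP[y /existsP[x dom]]]; exists y => //.
      by apply/bigcupP; exists x; rewrite // inE sE.
    move=> [y _ /bigcupP[x _]]; rewrite inE => /andP[-> dom]; split=> //.
    by apply/existsP; exists y; apply/existsP; exists x.
  apply: leq_trans (card_bigcup_le _ _ _ _) _.
  by apply: leq_sum => y _; apply: card_bigcup_le.
apply: leq_trans (leq_mul leB (leqnn _)) _; rewrite big_distrl /=.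
apply: leq_trans (_ : \sum_(y < n.+2) n.+2 * (3 ^ n * 2 ^ #|vertex_pairs n.+2|) <= _)%N.
  apply: leq_sum => y _; rewrite big_distrl /=.
  rewrite -[X in (_ <= X * _)%N]card_ord -sum_nat_const.
  by apply: leq_sum => x _; apply: leA.
by rewrite sum_nat_const card_ord mulnA.
Qed.

(** The shift by 10 makes the induction step valid from [n = 0], because [(11/10)^3 <= 4/3]; 1000 is
    then the base case. A cube, one degree above the union bound, leaves a decay of order [1/n]. *)
Lemma cube_le_expn (n : nat) : ((n + 10) ^ 3 * 3 ^ n <= 1000 * 4 ^ n)%N.
Proof.
elim: n => // n IHn; rewrite addSnnS (expnS 3) (expnS 4).
have step : (3 * (n + 11) ^ 3 <= 4 * (n + 10) ^ 3)%N by rewrite !expnS expn0; nia.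
rewrite mulnCA mulnA [leqRHS]mulnCA.
by apply: leq_trans (leq_mul step (leqnn _)) _; rewrite -mulnA leq_mul2l IHn.
Qed.

(** At one half, present and absent edges have equal weight, so probability becomes counting. *)
Lemma ER_prob_half (n : nat) (R : realType) (event : sgraph -> Prop) :
  ER_prob n (2^-1 : R) event =
  (#|[set E : {set {set 'I_n}} | (E \subset vertex_pairs n) && `[< event (labelled_graph E) >]]|%:R
     / 2 ^+ #|vertex_pairs n|)%R.
Proof.
rewrite mulr_natl -sumr_const; apply: eq_big => [E|E _]; first by rewrite inE.
rewrite /ER_weight (eq_bigr (fun=> 2^-1%R)) ?prodr_const ?exprVn // => e _.
by case: ifP => // _; lra.
Qed.

Lemma ER_prob_representable_le (n : nat) (R : realType) :
  (ER_prob n.+2 (2^-1 : R) group_representable <= 1000 * harmonic n.+2)%R.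
Proof.
rewrite ER_prob_half /harmonic /= ler_pdivrMr ?exprn_gt0 //.
rewrite mulrAC ler_pdivlMr // -natrX -!natrM ler_nat.
set B := [set E | _].
have leB := card_pairs_dominating n.
have subB : B \subset [set E : {set {set 'I_n.+2}} |
    (E \subset vertex_pairs n.+2) && [exists y, exists x, dominates (labelled_graph E) y x]].
  apply/subsetP => E; rewrite !inE => /andP[-> /asboolP rep].
  have [|y [x dom]] := representable_dominates _ _ rep; first by rewrite card_ord.
  by apply/existsP; exists y; apply/existsP; exists x.
have {}leB := leq_trans (leq_mul (subset_leq_card subB) (leqnn _)) leB.
(* Here [n.+3] is the denominator of [harmonic n.+2] and [n.+2 ^ 2] comes from the union bound. *)
have le_cube : (n.+3 * n.+2 ^ 2 <= (n + 10) ^ 3)%N by rewrite !expnS expn0; nia.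
have four_gt0 : (0 < 4 ^ n)%N by rewrite expn_gt0.
rewrite -(leq_pmul2r four_gt0) mulnAC [leqRHS]mulnAC mulnC.
apply: leq_trans (leq_mul (leqnn _) leB) _; rewrite !mulnA leq_mul2r.
apply/orP; right; apply: leq_trans (cube_le_expn n).
rewrite leq_mul2r -mulnA; apply/orP; right; exact: le_cube.
Qed.

Local Open Scope classical_set_scope.
Local Open Scope ring_scope.

Theorem proposition1p6 (R : realType) :
  (fun n : nat => ER_prob n (2^-1 : R) group_representable) @ \oo --> (0 : R).
Proof.
apply: (@squeeze_cvgr _ _ _ _ (fun=> 0) (fun n => 1000 * harmonic n)); last 2 first.
- exact: cvg_cst.
- by rewrite -[X in _ --> X](mulr0 1000); apply: cvgM; [exact: cvg_cst|exact: cvg_harmonic].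
near=> n.
have -> : n = n.-2.+2 by rewrite -subn2 -addn2 subnK //; near: n; exists 2%N.
apply/andP; split; last exact: ER_prob_representable_le.
by rewrite ER_prob_half divr_ge0 // exprn_ge0.
Unshelve. all: by end_near.
Qed.
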